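(* Let $K=\{4^m: m\ge 1\}\cup\{2\cdot p^m+2: p\in\{7,31,127\},\ m\ge 1\}$. There exists a $\mathrm{TOC}_3(n,3,3)$ for every $n\in K$.
   Context: $\mathcal{H}_q(n,w)$ is the set of all words of length $n$ over $\mathbb{Z}_q$ with exactly $w$ nonzero entries, with the Hamming distance. An $(n,d,w)_q$-code is a nonempty subset of $\mathcal{H}_q(n,w)$ in which any two distinct words have Hamming distance at least $d$; $A_q(n,d,w)$ is the maximum size of such a code and a code of this size is optimal. A $\mathrm{TOC}_q(n,d,w)$ is a partition of $\mathcal{H}_q(n,w)$ into mutually disjoint optimal $(n,d,w)_q$-codes. *)

(* Defs.v *)
From mathcomp Require Import all_boot.

(* Words of length n over Z_q, represented with the alphabet 'I_q = {0,...,q-1};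
   the zero symbol is the ordinal with value 0. *)
Definition word (q n : nat) := {ffun 'I_n -> 'I_q}.

Definition hwt (q n : nat) (x : word q n) : nat := #|[set i | val (x i) != 0]|.

Definition hdist (q n : nat) (x y : word q n) : nat := #|[set i | x i != y i]|.

Definition Hqnw (q n w : nat) : {set word q n} := [set x | hwt q n x == w].

Definition is_code (q n d w : nat) (C : {set word q n}) : bool :=
  [&& C != set0, C \subset Hqnw q n w &
      [forall x in C, forall y in C, (x != y) ==> (d <= hdist q n x y)]].

Definition Aq (q n d w : nat) : nat :=
  \max_(C : {set word q n} | is_code q n d w C) #|C|.

Definition optimal_code (q n d w : nat) (C : {set word q n}) : bool :=
  is_code q n d w C && (#|C| == Aq q n d w).

Definition TOC (q n d w : nat) (P : {set {set word q n}}) : bool :=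
  partition P (Hqnw q n w) && [forall C in P, optimal_code q n d w C].

Definition inK (n : nat) : Prop :=
  (exists m, 1 <= m /\ n = 4 ^ m) \/
  (exists p m, p \in [:: 7; 31; 127] /\ 1 <= m /\ n = 2 * p ^ m + 2).

(* Main.v *)
Require Import Defs.
From mathcomp Require Import all_boot all_algebra zify.
Set Implicit Arguments. Unset Strict Implicit. Unset Printing Implicit Defensive.
Import GRing.Theory.

(** Erasing a letter embeds the pairs (codeword, support point) of a code of
    minimum distance 3 and weight w + 1 over q + 1 letters into the words of
    weight w, and (w + 1) |H(w + 1)| = (n - w) q |H(w)|.  Hence a colouring of
    H(w + 1) with (n - w) q colours that separates words at distance at most 2
    has optimal classes only, and it remains to find one for q = w = 2.

    All n in K have the form 2|G| + 2 with G = (Z/(2^k - 1))^m and k odd (m = 1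
    gives the powers of 4).  Take the coordinates to be G x {0,1} together with
    two points at infinity, so that a word of weight 3 is a triple of signed
    points, and the colours to be G x F_4.  The G-colour of a triple is the sum
    of its three G-components.  A point at infinity borrows its component from
    one of the other points: from the only G-component present, if there is
    just one, and otherwise from the tail of an arc between the two finite
    points.  Arcs are oriented by a function f on G such that f(2x) = f(x) and
    f(-x) = ~ f(x) for x <> 0; it exists because the order of 2 is odd, so that
    x and -x lie on different orbits of doubling.

    The F_4-colour is affine in the signs, and its three coefficients are the
    nonzero elements of F_4, so it changes when one or two signs are flipped.
    Given two points, a G-colour is attained for at most two third points r and
    r'; the coefficients of these are arranged to be equal, to c say, and the
    constant terms to differ by an element outside {0, c}. *)

Lemma eq_of_sum_max (K : finType) (F : K -> nat) m :
  (forall k, F k <= m) -> \sum_k F k = #|K| * m -> forall k, F k = m.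
Proof.
move=> le_m sumF k; apply/eqP; move: k; apply/forallP.
have [_ <-] := leqif_sum (fun k (_ : true) => leqif_eq (le_m k)).
by rewrite sumF sum_nat_const.
Qed.

Section ConstantWeightCodes.
Variables q n : nat.
Implicit Types (x y : word q.+1 n) (w : nat) (A : {set 'I_n}) (C : {set word q.+1 n}).

Definition supp x : {set 'I_n} := [set i | val (x i) != 0].

Lemma in_supp x i : (i \in supp x) = (x i != ord0).
Proof. by rewrite inE. Qed.

Lemma in_Hqnw w x : (x \in Hqnw q.+1 n w) = (#|supp x| == w).
Proof. by rewrite inE. Qed.

Lemma card_supp_eq A : #|[set x | supp x == A]| = q ^ #|A|.
Proof.
transitivity #|pffun_on (ord0 : 'I_q.+1) A (predC1 ord0)|.
  apply: eq_card => x; rewrite inE; apply/eqP/pffun_onP => [<-|[/subsetP xA x0]].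
    split=> [|z /imageP[i]]; first by apply/subsetP=> i; rewrite !inE.
    by rewrite !inE => + ->.
  apply/setP=> i; rewrite in_supp; apply/idP/idP=> [/xA//|iA].
  by have := x0 (x i); rewrite !inE; apply; apply: image_f.
by rewrite card_pffun_on cardC1 card_ord.
Qed.

Lemma card_Hqnw w : #|Hqnw q.+1 n w| = 'C(n, w) * q ^ w.
Proof.
rewrite -sum1_card (partition_big supp (fun A => #|A| == w)) => [|x]; last first.
  by rewrite in_Hqnw.
rewrite -[n in 'C(n, _)]card_ord -card_draws cardsE -sum_nat_const.
apply: eq_bigr => A /eqP wA; rewrite -{2}wA -card_supp_eq -sum1_card.
by apply: eq_bigl => x; rewrite in_Hqnw inE andbC; case: eqP => // ->; rewrite wA eqxx.
Qed.

Lemma card_HqnwS w :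
  #|Hqnw q.+1 n w.+1| * w.+1 = (n - w) * q * #|Hqnw q.+1 n w|.
Proof. by rewrite !card_Hqnw mulnAC ['C(n, _) * _]mulnC mul_bin_left expnS mulnACA. Qed.

Definition erase x (i : 'I_n) : word q.+1 n := [ffun j => if j == i then ord0 else x j].

Lemma supp_erase x i : supp (erase x i) = supp x :\ i.
Proof. by apply/setP=> j; rewrite !inE ffunE; case: (j == i). Qed.

Lemma hdist_erase x y i j : erase x i = erase y j -> hdist q.+1 n x y <= 2.
Proof.
move=> /ffunP eq_xy; apply: (@leq_trans #|[set i; j]|); last by rewrite cards2 ltnS leq_b1.
apply: subset_leq_card; apply/subsetP=> k; rewrite !inE; apply: contraR.
rewrite negb_or => /andP[/negPf ki /negPf kj].
by have := eq_xy k; rewrite !ffunE ki kj => ->.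
Qed.

Lemma card_code_le w C :
  is_code q.+1 n 3 w.+1 C -> #|C| * w.+1 <= #|Hqnw q.+1 n w|.
Proof.
move=> /and3P[_ /subsetP CH /forall_inP C_far].
rewrite -sum_nat_const (eq_bigr (fun x => \sum_(i in supp x) 1)) => [|x xC]; last first.
  by rewrite sum1_card; apply/esym/eqP; rewrite -in_Hqnw CH.
rewrite pair_big_dep /= sum1dep_card -(card_in_imset (f := fun p => erase p.1 p.2)).
  apply: subset_leq_card; apply/subsetP=> _ /imsetP[[x i] + ->].
  rewrite in_set /= => /andP[xC xi].
  by have := CH x xC; rewrite !in_Hqnw supp_erase (cardsD1 i) xi.
move=> [x i] [y j] /[!in_set]/= /andP[xC xi] /andP[yC _] eq_xy.
have xy : x = y.
  apply: contraTeq (hdist_erase eq_xy); rewrite -ltnNge.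
  by have /forall_inP/(_ y yC)/implyP := C_far x xC.
congr (_, _) => //; apply: contraTeq xi => ij.
by move/ffunP/(_ i): eq_xy; rewrite !ffunE eqxx (negPf ij) -xy => <-.
Qed.

Lemma optimal_code_of_card w C : is_code q.+1 n 3 w.+1 C ->
  #|C| * w.+1 = #|Hqnw q.+1 n w| -> optimal_code q.+1 n 3 w.+1 C.
Proof.
move=> codeC cardC; rewrite /optimal_code codeC eqn_leq /Aq (leq_bigmax_cond C) //=.
by apply/bigmax_leqP=> D /card_code_le; rewrite -cardC leq_pmul2r.
Qed.

Lemma TOC_of_colouring w (K : finType) (c : word q.+1 n -> K) : #|K| = (n - w) * q ->
  {in Hqnw q.+1 n w.+1 &, forall x y, x != y -> hdist q.+1 n x y <= 2 -> c x != c y} ->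
  exists P, TOC q.+1 n 3 w.+1 P.
Proof.
set H := Hqnw _ _ _ => cardK c_proper.
pose class k := [set x in H | c x == k].
have code_class k : class k != set0 -> is_code q.+1 n 3 w.+1 (class k).
  move=> k0; apply/and3P; split=> //; first by apply/subsetP=> x /setIdP[].
  apply/forall_inP=> x /setIdP[xH /eqP xk]; apply/forall_inP=> y /setIdP[yH /eqP yk].
  apply/implyP=> xy; rewrite ltnNge; apply: contraL (eqxx k) => /(c_proper x y xH yH xy).
  by rewrite xk yk.
have card_class k : #|class k| * w.+1 = #|Hqnw q.+1 n w|.
  apply: (@eq_of_sum_max _ (fun k => #|class k| * w.+1)) => [i|].
    by have [->|/code_class/card_code_le//] := eqVneq (class i) set0; rewrite cards0.
  rewrite -big_distrl cardK -card_HqnwS -[#|H|]sum1_card (partition_big c predT) //=.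
  congr (_ * _); apply: eq_bigr => i _; rewrite -sum1_card.
  by apply: eq_bigl => x; rewrite inE.
exists (preim_partition c H); rewrite /TOC preim_partitionP /=.
apply/forall_inP=> _ /imsetP[x xH ->]; have <- : class (c x) = [set y in H | c x == c y].
  by apply/setP=> y; rewrite !inE [c y == _]eq_sym.
apply: optimal_code_of_card => //; apply: code_class; apply/set0Pn; exists x.
by rewrite inE xH eqxx.
Qed.

End ConstantWeightCodes.

Definition is_triple (T : finType) (A : {set T}) (a b c : T) : bool :=
  (A == [set a; b; c]) && uniq [:: a; b; c].

Lemma is_triple_in (T : finType) (A : {set T}) a b c : is_triple A a b c ->
  [/\ a \in A, b \in A, c \in A & uniq [:: a; b; c]].
Proof. by case/andP=> /eqP-> abc; rewrite !inE !eqxx !orbT. Qed.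

Lemma is_triple_third (T : finType) (A : {set T}) a b : #|A| = 3 ->
  a \in A -> b \in A -> a != b -> exists c, is_triple A a b c.
Proof.
move=> A3 aA bA ab; have abA : [set a; b] \subset A by apply/subsetP=> i /set2P[]->.
have /cards1P[c defc] : #|A :\: [set a; b]| == 1 by rewrite cardsDS // A3 cards2 ab.
have cA : c \in A :\: [set a; b] by rewrite defc set11.
exists c; rewrite /is_triple -{1}(setID A [set a; b]) defc (setIidPr abA) eqxx /=.
by move: cA; rewrite !inE !negb_or ab ![c == _]eq_sym => /andP[/andP[-> ->]].
Qed.

Lemma symmetric_perm2 (T : eqType) (R : Type) (F : T -> T -> R) p q a b :
  (forall x y, F x y = F y x) -> perm_eq [:: p; q] [:: a; b] -> F p q = F a b.
Proof.
move=> FC /perm_mem mem_pq.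
have := mem_pq b; have := mem_pq a; have := mem_pq q; have := mem_pq p.
rewrite !inE !eqxx !orbT => /esym/orP[]/eqP-> /esym/orP[]/eqP->; rewrite ?orbb //.
- by move=> _ /eqP->.
- by move=> /eqP->.
Qed.

Lemma symmetric_perm3 (T : eqType) (R : Type) (F : T -> T -> T -> R) p q r a b c :
  (forall x y z, F x y z = F y x z) -> (forall x y z, F x y z = F x z y) ->
  perm_eq [:: p; q; r] [:: a; b; c] -> F p q r = F a b c.
Proof.
move=> FC FCr pqr; have : p \in [:: a; b; c] by rewrite -(perm_mem pqr) mem_head.
rewrite !inE => /or3P[]/eqP eq_p; move: pqr; rewrite eq_p.
- by rewrite perm_cons; apply: (symmetric_perm2 (F := F a)).
- rewrite perm_sym (perm_catCA [:: a] [:: b] [:: c]) perm_cons perm_sym.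
  by rewrite (FC a); apply: (symmetric_perm2 (F := F b)).
- rewrite perm_sym (perm_catC [:: a; b] [:: c]) perm_cons perm_sym.
  by rewrite (FCr a) (FC a); apply: (symmetric_perm2 (F := F c)).
Qed.

Section CloseWords.
Variables q n : nat.
Implicit Types (x y : word q.+1 n) (a b c d : 'I_n).

Variant close_words_spec x y : Prop :=
| CloseWordsReplace a b c d of is_triple (supp x) a b c & is_triple (supp y) a b d
    & x a = y a & x b = y b & c = d -> x c != y c
| CloseWordsChange2 a b c of is_triple (supp x) a b c & is_triple (supp y) a b c
    & x a != y a & x b != y b & x c = y c.

Lemma close_words_agree2 x y a b : #|supp x| = 3 -> #|supp y| = 3 -> x != y ->
  a \in supp x -> b \in supp x -> a != b -> x a = y a -> x b = y b -> close_words_spec x y.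
Proof.
move=> x3 y3 xy ax bx ab xya xyb; have [c xabc] := is_triple_third x3 ax bx ab.
have [d yabd] : exists d, is_triple (supp y) a b d.
  by apply: is_triple_third; rewrite // in_supp -?xya -?xyb -in_supp.
apply: (CloseWordsReplace xabc yabd xya xyb) => eq_cd.
have [/andP[/eqP defx _] /andP[/eqP defy _]] := (xabc, yabd).
apply: contra xy => /eqP xyc; apply/eqP/ffunP=> i; have [|ix] := boolP (i \in supp x).
  by rewrite defx -setUA => /setU1P[->|/set2P[]->].
have iy : i \notin supp y by rewrite defy -eq_cd -defx.
by move: ix iy; rewrite !in_supp !negbK => /eqP-> /eqP->.
Qed.

Lemma close_wordsP x y : x \in Hqnw q.+1 n 3 -> y \in Hqnw q.+1 n 3 ->
  x != y -> hdist q.+1 n x y <= 2 -> close_words_spec x y.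
Proof.
rewrite !in_Hqnw => /eqP x3 /eqP y3 xy dxy.
pose E := [set i | x i != y i]; have dE : #|E| <= 2 by [].
have agree i : i \notin E -> x i = y i by rewrite inE negbK => /eqP.
have cardD : #|supp x :&: E| + #|supp x :\: E| = 3 by rewrite cardsID.
have leI : #|supp x :&: E| <= 2 := leq_trans (subset_leq_card (subsetIr _ _)) dE.
have [/card_gt1P[a [b [/setDP[ax aE] /setDP[bx bE] ab]]] | leD] := ltnP 1 #|supp x :\: E|.
  exact: close_words_agree2 x3 y3 xy ax bx ab (agree a aE) (agree b bE).
have D1 : #|supp x :\: E| = 1.
  by apply/eqP; rewrite eqn_leq leD -(ltn_add2l #|supp x :&: E|) addn0 cardD ltnS.
have /cards1P[c defD] : #|supp x :\: E| == 1 by apply/eqP.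
have I2 : #|supp x :&: E| = 2 by move: cardD; rewrite D1 addn1 => -[].
have defI : supp x :&: E = E by apply/eqP; rewrite eqEcard subsetIr I2.
have /cards2P[a [b [ab defE]]] : #|E| == 2 by rewrite -defI I2.
have /setDP[cx cE] : c \in supp x :\: E by rewrite defD set11.
have [aE bE] : a \in E /\ b \in E by rewrite defE set21 set22.
have xabc : is_triple (supp x) a b c.
  move: cE; rewrite /is_triple -(setID (supp x) E) defD defI defE eqxx /= !inE.
  by rewrite !negb_or ab ![c == _]eq_sym => /andP[-> ->].
have yx : supp y = supp x.
  apply/eqP; rewrite eqEcard x3 y3 leqnn andbT; apply/subsetP=> i iy.
  have [iE|/agree xyi] := boolP (i \in E); first by move: iE; rewrite -defI => /setIP[].
  by rewrite in_supp xyi -in_supp.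
rewrite !in_set in aE bE.
by apply: (CloseWordsChange2 xabc); rewrite ?yx ?(agree c cE).
Qed.

End CloseWords.

Definition flip (X : Type) (P : X * bool) : X * bool := (P.1, ~~ P.2).

Section TripleColouring.
Variable n : nat.
Implicit Types (x y : word 3 n) (a b c d : 'I_n).

Variables (X : eqType) (K : finType) (F : X * bool -> X * bool -> X * bool -> K) (k0 : K).
Variables (phi : 'I_n -> X).
Hypothesis phi_inj : injective phi.
Hypothesis FC : forall P Q R, F P Q R = F Q P R.
Hypothesis FCr : forall P Q R, F P Q R = F P R Q.
Hypothesis F_inj : forall P Q R R', uniq [:: P.1; Q.1; R.1] -> uniq [:: P.1; Q.1; R'.1] ->
  F P Q R = F P Q R' -> R = R'.
Hypothesis F_flip : forall P Q R, uniq [:: P.1; Q.1; R.1] ->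
  F P Q R != F (flip P) (flip Q) R.

(* The nonzero letters 1 and 2 are read as signs. *)
Definition signed x a : X * bool := (phi a, val (x a) == 2).

Definition colour x : K :=
  if enum (supp x) is [:: a; b; c] then F (signed x a) (signed x b) (signed x c) else k0.

Lemma colourE x a b c : is_triple (supp x) a b c ->
  colour x = F (signed x a) (signed x b) (signed x c).
Proof.
move=> /andP[/eqP defx abc].
have : perm_eq (enum (supp x)) [:: a; b; c].
  by apply: uniq_perm; rewrite ?enum_uniq // => i; rewrite mem_enum defx !inE orbA.
rewrite /colour; case: (enum _) => [|i [|j [|k [|l s]]]] ijk; try by have := perm_size ijk.
exact: (symmetric_perm3 (F := fun i j k => F (signed x i) (signed x j) (signed x k))).
Qed.

Lemma uniq_signed x y z a b c :
  uniq [:: (signed x a).1; (signed y b).1; (signed z c).1] = uniq [:: a; b; c].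
Proof. by rewrite -(map_inj_uniq phi_inj). Qed.

Lemma signed_flip x y a : a \in supp x -> a \in supp y -> x a != y a ->
  signed y a = flip (signed x a).
Proof. by rewrite !in_supp /signed /flip; case: (x a) (y a) => [[|[|[|?]]] ?] [[|[|[|?]]] ?]. Qed.

Lemma colour_proper :
  {in Hqnw 3 n 3 &, forall x y, x != y -> hdist 3 n x y <= 2 -> colour x != colour y}.
Proof.
move=> x y xH yH xy dxy.
have eq_signed i : x i = y i -> signed y i = signed x i by rewrite /signed => ->.
case: (close_wordsP xH yH xy dxy) => [a b c d|a b c] x_abc y_abc xy_a xy_b xy_c;
  have [ax bx cx uniq_x] := is_triple_in x_abc; have [ay bY cy uniq_y] := is_triple_in y_abc;
  rewrite (colourE x_abc) (colourE y_abc).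
  rewrite (eq_signed a) // (eq_signed b) //; apply/eqP=> /F_inj; rewrite !uniq_signed => eq_cd.
  have {}eq_cd := eq_cd uniq_x uniq_y.
  have cd : c = d by apply: phi_inj; move: eq_cd => [].
  move: (xy_c cd) cy eq_cd; rewrite -cd => {}xy_c cy; rewrite (signed_flip cx cy xy_c).
  by case; case: (_ == _).
rewrite (signed_flip ax ay) // (signed_flip bx bY) // (eq_signed c) //.
by apply: F_flip; rewrite uniq_signed.
Qed.

Lemma TOC_of_triple_colouring :
  #|K| = 2 * (n - 2) -> exists P, TOC 3 n 3 3 P.
Proof. by move=> cardK; apply: TOC_of_colouring colour_proper; rewrite cardK mulnC. Qed.

End TripleColouring.

Local Open Scope ring_scope.

Section SymmetricSum.
Variables (X : Type) (V : zmodType) (s : X -> X -> X -> V).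
Hypothesis sC : forall p q r, s p q r = s p r q.

Definition sym_sum p q r : V := s p q r + s q p r + s r p q.

Lemma sym_sumC p q r : sym_sum p q r = sym_sum q p r.
Proof. by rewrite /sym_sum [s p q r + _]addrC (sC r). Qed.

Lemma sym_sumCr p q r : sym_sum p q r = sym_sum p r q.
Proof. by rewrite /sym_sum (sC p) addrAC. Qed.

End SymmetricSum.

Lemma uniq3C (T : eqType) (p q r : T) : uniq [:: p; q; r] = uniq [:: q; p; r].
Proof. by apply: perm_uniq; rewrite (perm_catCA [:: p] [:: q]). Qed.

Lemma uniq3Cr (T : eqType) (p q r : T) : uniq [:: p; q; r] = uniq [:: p; r; q].
Proof. by apply: perm_uniq; rewrite perm_cons (perm_catC [:: q]). Qed.

(* The additive group of the field with four elements; omega is the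
   multiplication by a primitive element. *)
Definition F4 := (bool * bool)%type.

Section F4Theory.
Implicit Types u a b c d : F4.

Definition omega u : F4 := (u.2, u.1 + u.2).

Lemma F4_opp u : - u = u.
Proof. by case: u => [[] []]. Qed.

Lemma mulrb_negb a (x : bool) : a *+ ~~ x = a *+ x + a.
Proof. by case: a x => [[] []] []. Qed.

Lemma mulrb_inj a : a != 0 -> injective (fun x : bool => a *+ x).
Proof. by move=> a0 [] []//; case: a a0 => [[] []]. Qed.

Lemma signed_sum_coset a b a' b' c (x y z z' : bool) :
  uniq [:: 0; a; b; c] -> uniq [:: 0; a'; b'; c] ->
  (a *+ x + b *+ y + c *+ z) - (a' *+ x + b' *+ y + c *+ z') \in [:: 0; c].
Proof.
case: a b c => [[] []] [[] []] [[] []] // _; case: a' b' => [[] []] [[] []] // _;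
by case: x y z z' => [] [] [] [].
Qed.

Lemma omega_coset a b c d : uniq [:: a; b; c] -> uniq [:: a; b; d] -> c != d ->
  (omega a + omega b + omega c) - (omega a + omega b + omega d) \notin [:: 0; a + b].
Proof. by case: a b c d => [[] []] [[] []] [[] []] [[] []]. Qed.

Lemma omega_mulrb_coset a (x y : bool) : a != 0 -> x != y ->
  omega a *+ x - omega a *+ y \notin [:: 0; a].
Proof. by case: a x y => [[] []] [] []. Qed.

End F4Theory.

Section AffineColouring.
Variables (X : eqType) (G : zmodType).
Variables (shadow : X -> X -> X -> G) (offset coef : X -> X -> X -> F4).

(* Once the coefficients at r and r' are equal, to c say, a change of the signs
   moves the difference of the two colours by 0 or c only. *)
Definition splits_colour p q r r' : bool :=
  (coef r p q == coef r' p q) &&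
  (sym_sum offset p q r - sym_sum offset p q r' \notin [:: 0; coef r p q]).

Definition shadow_splits p q : Prop := forall r r',
  uniq [:: p; q; r] -> uniq [:: p; q; r'] -> r != r' ->
  sym_sum shadow p q r = sym_sum shadow p q r' -> splits_colour p q r r'.

Hypothesis shadowC : forall p q r, shadow p q r = shadow p r q.
Hypothesis offsetC : forall p q r, offset p q r = offset p r q.
Hypothesis coefC : forall p q r, coef p q r = coef p r q.
Hypothesis coef_neq0 : forall p q r, uniq [:: p; q; r] -> coef p q r != 0.
Hypothesis coef_neq : forall p q r, uniq [:: p; q; r] -> coef p q r != coef q p r.
Hypothesis splitsP : forall p q, shadow_splits p q.

Implicit Types P Q R : X * bool.

Lemma splits_colourC p q r r' : splits_colour p q r r' = splits_colour q p r r'.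
Proof. by rewrite /splits_colour !(sym_sumC offsetC p q) !(coefC _ p). Qed.

Lemma splits_colourCr p q r r' : splits_colour p q r r' = splits_colour p q r' r.
Proof.
by rewrite /splits_colour eq_sym; case: eqP => //= ->; rewrite -opprB F4_opp.
Qed.

Definition signed_term P Q R : F4 := offset P.1 Q.1 R.1 + coef P.1 Q.1 R.1 *+ P.2.

Definition affine_colour P Q R : G * F4 :=
  (sym_sum shadow P.1 Q.1 R.1, sym_sum signed_term P Q R).

Lemma signed_termC P Q R : signed_term P Q R = signed_term P R Q.
Proof. by rewrite /signed_term offsetC coefC. Qed.

Lemma affine_colourC P Q R : affine_colour P Q R = affine_colour Q P R.
Proof. by rewrite /affine_colour sym_sumC // (sym_sumC signed_termC). Qed.

Lemma affine_colourCr P Q R : affine_colour P Q R = affine_colour P R Q.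
Proof. by rewrite /affine_colour sym_sumCr // (sym_sumCr signed_termC). Qed.

Lemma sym_sum_signed_term p q r (x y z : bool) :
  sym_sum signed_term (p, x) (q, y) (r, z) =
  sym_sum offset p q r + (coef p q r *+ x + coef q p r *+ y + coef r p q *+ z).
Proof. by rewrite /sym_sum /signed_term /= (addrACA (offset p q r)) [LHS]addrACA. Qed.

Lemma uniq_coef p q r : uniq [:: p; q; r] -> uniq [:: 0; coef p q r; coef q p r; coef r p q].
Proof.
move=> pqr; have prq : uniq [:: p; r; q] by rewrite uniq3Cr.
have qpr : uniq [:: q; p; r] by rewrite uniq3C.
have qrp : uniq [:: q; r; p] by rewrite uniq3Cr.
have rpq : uniq [:: r; p; q] by rewrite uniq3C.
rewrite /= !inE !negb_or ![0 == _]eq_sym !coef_neq0 ?coef_neq //=.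
by rewrite coefC coef_neq //= coefC (coefC r) coef_neq.
Qed.

Lemma affine_colour_inj P Q R R' : uniq [:: P.1; Q.1; R.1] -> uniq [:: P.1; Q.1; R'.1] ->
  affine_colour P Q R = affine_colour P Q R' -> R = R'.
Proof.
case: P Q R R' => [p x] [q y] [r z] [r' z'] /= pqr pqr' /pair_equal_spec[eq_shadow].
rewrite !sym_sum_signed_term => eq_F4.
have uniq_r := uniq_coef pqr; have uniq_r' := uniq_coef pqr'.
have [eq_r|rr'] := eqVneq r r'.
  move: eq_F4 => /[!eq_r]/addrI/addrI/mulrb_inj-> //.
  by rewrite coef_neq0 // uniq3C uniq3Cr.
have /andP[/eqP eq_coef /negP[]] := splitsP pqr pqr' rr' eq_shadow.
rewrite -eq_coef in eq_F4 uniq_r'.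
have -> : sym_sum offset p q r - sym_sum offset p q r' =
    coef p q r' *+ x + coef q p r' *+ y + coef r p q *+ z' -
    (coef p q r *+ x + coef q p r *+ y + coef r p q *+ z).
  by apply/eqP; rewrite subr_eq addrAC eq_sym subr_eq eq_sym addrC eq_F4 addrC.
exact: signed_sum_coset.
Qed.

Lemma affine_colour_flip P Q R : uniq [:: P.1; Q.1; R.1] ->
  affine_colour P Q R != affine_colour (flip P) (flip Q) R.
Proof.
case: P Q R => [p x] [q y] [r z] pqr; apply/eqP => /pair_equal_spec[_].
rewrite !sym_sum_signed_term => /addrI/addIr/eqP.
rewrite !mulrb_negb addrACA -subr_eq0 opprD addrA subrr sub0r oppr_eq0 addr_eq0 F4_opp.
by rewrite (negPf (coef_neq pqr)).
Qed.

End AffineColouring.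

Lemma injective_mulrn (V : zmodType) n :
  (forall x : V, x *+ n = 0 -> x = 0) -> injective (fun x : V => x *+ n).
Proof.
move=> torsion_free x y /eqP; rewrite -subr_eq0 -mulrnBl => /eqP/torsion_free/eqP.
by rewrite subr_eq0 => /eqP.
Qed.

Section Construction.
Variables (G : finZmodType) (f : G -> bool).

(* inl b is the point b at infinity. *)
Definition point := (bool + G * bool)%type.

Implicit Types (p q r : point) (g h k : G) (s t u : G * bool) (b e i j l : bool).

Definition label p : F4 := match p with inl b => (false, b) | inr s => (true, s.2) end.

Definition axis i : F4 := (~~ i, i).
Definition diag : F4 := (true, true).

Definition arc b s t : bool := f (t.1 - s.1) (+) s.2 (+) t.2 (+) b.
Definition tail b s t := if arc b s t then s else t.
Definition head b s t := if arc b s t then t else s.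

(* Lemma [splits_arc_fibre] determines these constants up to multiples of
   [axis (~~ i)]; the last term solves the equations on the multiples that come
   from Lemma [splits_arc_out_in]. *)
Definition arc_offset e i j : F4 :=
  axis e *+ j + axis i + axis (~~ i) *+ (if i == j then i && ~~ e else i || ~~ e).

(* Any symmetric choice of distinct nonzero coefficients for three distinct
   elements of G would do. *)
Definition rank g h k : nat :=
  ((enum_rank h < enum_rank g) + (enum_rank k < enum_rank g))%N.

Definition rank_coef g h k : F4 := iter (rank g h k) omega (true, false).

Definition shadow p q r : G :=
  match p, q, r with
  | inr s, _, _ => s.1
  | inl b, inr s, inr t => (tail b s t).1
  | inl _, inr s, inl _ | inl _, inl _, inr s => s.1
  | inl _, inl _, inl _ => 0
  end.

(* [coef p q r] and [offset p q r] are the contributions of the point p of the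
   triple {p, q, r}.  The equality tests single out the triples over one element
   of G, which are coloured through the labels in F_4, and those with two points
   over the same element. *)
Definition coef p q r : F4 :=
  match p, q, r with
  | inr s, inr t, inr u =>
    if t.1 == u.1 then diag else if s.1 \in [:: t.1; u.1] then axis s.2
    else rank_coef s.1 t.1 u.1
  | inl b, inr s, inr t =>
    if s.1 == t.1 then label q + label r else axis (~~ (tail b s t).2)
  | inr s, inl b, inr t | inr s, inr t, inl b =>
    if s.1 == t.1 then label q + label r
    else if (s.2 == t.2) (+) arc b s t then diag else axis t.2
  | _, _, _ => label q + label r
  end.

Definition offset p q r : F4 :=
  match p, q, r with
  | inr s, inr t, inr u =>
    if t.1 == u.1 then axis (f (s.1 - t.1)) *+ s.2
    else if s.1 \in [:: t.1; u.1] then 0 else omega (rank_coef s.1 t.1 u.1) *+ s.2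
  | inl b, inr s, inr t =>
    if s.1 == t.1 then omega (label p)
    else arc_offset (f ((head b s t).1 - (tail b s t).1)) (tail b s t).2 (head b s t).2
  | inr s, inl _, inr t | inr s, inr t, inl _ => if s.1 == t.1 then omega (label p) else 0
  | _, _, _ => omega (label p)
  end.

Hypothesis f_twice : forall g, f (g *+ 2) = f g.
Hypothesis f_opp : forall g, g != 0 -> f (- g) = ~~ f g.

Lemma mulr2n_inj : injective (fun g => g *+ 2).
Proof.
apply: injective_mulrn => g /eqP; rewrite mulr2n addr_eq0 => /eqP eq_opp.
by apply/eqP; apply: contraT => /f_opp; rewrite -eq_opp; case: (f g).
Qed.

Lemma mulr3n_inj : injective (fun g => g *+ 3).
Proof.
apply: injective_mulrn => g /eqP; rewrite mulrS addrC addr_eq0 => /eqP eq_opp.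
by apply/eqP; apply: contraT => /f_opp; rewrite -eq_opp f_twice; case: (f g).
Qed.

Lemma f_subC g h : g != h -> f (g - h) = ~~ f (h - g).
Proof. by move=> gh; rewrite -f_opp ?opprB // subr_eq0 eq_sym. Qed.

Lemma arcC b s t : s.1 != t.1 -> arc b t s = ~~ arc b s t.
Proof. by move=> st; rewrite /arc (f_subC st) !addNb [_ (+) t.2 (+) s.2]addbAC. Qed.

Lemma tailC b s t : s.1 != t.1 -> tail b t s = tail b s t.
Proof. by move=> st; rewrite /tail arcC //; case: arc. Qed.

Lemma headC b s t : s.1 != t.1 -> head b t s = head b s t.
Proof. by move=> st; rewrite /head arcC //; case: arc. Qed.

Lemma shadowC p q r : shadow p q r = shadow p r q.
Proof.
case: p q r => [b|s] [c|t] [d|u] //=; have [tu|tu] := eqVneq t.1 u.1; last by rewrite -tailC.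
by rewrite /tail; do 2!case: ifP => _.
Qed.

Lemma rank_coefC g h k : rank_coef g h k = rank_coef g k h.
Proof. by rewrite /rank_coef /rank addnC. Qed.

Lemma coefC p q r : coef p q r = coef p r q.
Proof.
case: p q r => [b|s] [c|t] [d|u] //=; try by rewrite addrC.
  by rewrite eq_sym addrC; case: eqVneq => // ut; rewrite tailC.
by rewrite eq_sym !inE orbC rank_coefC.
Qed.

Lemma offsetC p q r : offset p q r = offset p r q.
Proof.
case: p q r => [b|s] [c|t] [d|u] //=.
  by rewrite eq_sym; case: eqVneq => // ut; rewrite tailC // headC.
by rewrite !inE orbC rank_coefC; case: eqVneq => // ->.
Qed.

Lemma fibre_eqE g i j : (inr (g, i) == inr (g, j) :> point) = (i == j).
Proof. by rewrite (inj_eq inr_inj) xpair_eqE eqxx. Qed.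

Lemma no_three_inf b c d : ~ uniq [:: inl b; inl c; inl d : point].
Proof. by case: b c d => [] [] []. Qed.

Lemma no_three_fibre g i j l :
  ~ uniq [:: inr (g, i); inr (g, j); inr (g, l) : point].
Proof. by rewrite /= !inE !fibre_eqE; case: i j l => [] [] []. Qed.

Lemma rank_neq g h k : uniq [:: g; h; k] -> rank g h k != rank h g k.
Proof.
rewrite /= !inE negb_or andbT -!(inj_eq (@enum_rank_inj G)) -!val_eqE /rank /=.
move: (nat_of_ord _) (nat_of_ord _) (nat_of_ord _) => i j l; lia.
Qed.

Lemma rank_coef_neq0 g h k : rank_coef g h k != 0.
Proof. by rewrite /rank_coef /rank; do 2!case: (_ < _)%N. Qed.

Lemma rank_coef_neq g h k : uniq [:: g; h; k] -> rank_coef g h k != rank_coef h g k.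
Proof.
move=> /rank_neq; rewrite /rank_coef /rank.
by do 4!case: (_ < _)%N.
Qed.

Lemma axis_neq0 i : axis i != 0.
Proof. by case: i. Qed.

Lemma coef_neq0 p q r : uniq [:: p; q; r] -> coef p q r != 0.
Proof.
case: p q r => [b|[g i]] [c|[h j]] [d|[k l]] //=; rewrite !inE ?andbT //.
- by case: b c d => [] [] [].
- case: (eqVneq h k) => [<-|_ _]; last exact: axis_neq0.
  by rewrite fibre_eqE; case: j l => [] [].
- by case: c d => [] [].
- case: (eqVneq g k) => // _ _; case: ifP => // _; exact: axis_neq0.
- case: (eqVneq g h) => // _ _; case: ifP => // _; exact: axis_neq0.
- move=> _; case: (eqVneq h k) => // _.
  by case: ifP => _; [apply: axis_neq0 | apply: rank_coef_neq0].
Qed.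

Lemma coef_neq p q r : uniq [:: p; q; r] -> coef p q r != coef q p r.
Proof.
case: p q r => [b|[g i]] [c|[h j]] [d|[k l]] //=; rewrite !inE ?andbT //.
- by case: b c d => [] [] [].
- by case: b c l => [] [] [].
- by case: (eqVneq h k) => // _ _; rewrite /tail; case: (arc _ _ _); case: j l => [] [] /=.
- by case: (eqVneq g k) => // _ _; rewrite /tail; case: (arc _ _ _); case: i l => [] [] /=.
- case: (eqVneq g h) => [<-|gh]; first by rewrite fibre_eqE; case: d i j => [] [] [].
  move=> _.
  by rewrite (arcC _ (s := (g, i))) //; case: (arc _ _ _); case: i j => [] [] /=.
case: (eqVneq g h) => [<-|gh]; case: (eqVneq g k) => [<-|gk] //=.
- by rewrite !fibre_eqE; case: i j l => [] [] [].
- by rewrite fibre_eqE; case: i j => [] [].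
- by rewrite [h == g]eq_sym (negPf gh); case: i.
case: (eqVneq h k) => [_ _|hk _] /=; first by case: j.
by apply: rank_coef_neq; rewrite /= !inE negb_or gh gk hk.
Qed.

Local Notation splits := (splits_colour offset coef).

Definition fibre g p : bool := if p is inr s then s.1 == g else true.

Lemma label_inj g : {in fibre g &, injective label}.
Proof.
move=> [b|[h i]] [c|[k j]]; rewrite !unfold_in //=; first by move=> _ _ [->].
by move=> /eqP-> /eqP-> [->].
Qed.

Lemma central_block g p q r : fibre g p -> fibre g q -> fibre g r -> uniq [:: p; q; r] ->
  coef p q r = label q + label r /\ offset p q r = omega (label p).
Proof.
case: p q r => [b|[h i]] [c|[k j]] [d|[l m]] /=; do 3![move=> /eqP-> | move=> _];
  rewrite ?eqxx // !inE !fibre_eqE.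
by case: i j m => [] [] [].
Qed.

Lemma splits_central g p q r r' : fibre g p -> fibre g q -> fibre g r -> fibre g r' ->
  uniq [:: p; q; r] -> uniq [:: p; q; r'] -> r != r' -> splits p q r r'.
Proof.
move=> pg qg rg r'g pqr pqr' rr'.
have block z : fibre g z -> uniq [:: p; q; z] ->
    [/\ coef z p q = label p + label q,
        sym_sum offset p q z = omega (label p) + omega (label q) + omega (label z)
      & uniq [:: label p; label q; label z]].
  move=> zg pqz; have qpz : uniq [:: q; p; z] by rewrite uniq3C.
  have zpq : uniq [:: z; p; q] by rewrite uniq3C uniq3Cr.
  have [[_ offset_p] [_ offset_q]] := (central_block pg qg zg pqz, central_block qg pg zg qpz).
  have [-> offset_z] := central_block zg pg qg zpq.
  rewrite /sym_sum offset_p offset_q offset_z; split=> //.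
  rewrite -[[:: label p; _; _]]/(map label [:: p; q; z]) map_inj_in_uniq //.
  by apply: sub_in2 (@label_inj g) => x; rewrite !inE => /or3P[]/eqP->.
have [coef_r sum_r lab_r] := block r rg pqr.
have [coef_r' sum_r' lab_r'] := block r' r'g pqr'.
rewrite /splits_colour coef_r coef_r' sum_r sum_r' eqxx.
by apply: omega_coset; rewrite // (inj_in_eq (@label_inj g)).
Qed.

Lemma splits_arc_out_in b s t u : s.1 != t.1 -> s.1 != u.1 -> f (t.1 - s.1) = f (u.1 - s.1) ->
  arc b s t -> arc b u s -> splits (inl b) (inr s) (inr t) (inr u).
Proof.
move=> st su eq_f arc_st arc_us.
have [ts us] : t.1 != s.1 /\ u.1 != s.1 by rewrite ![_ == s.1]eq_sym.
rewrite /splits_colour /sym_sum /= /head /tail (arcC _ st) (arcC _ us) arc_st arc_us.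
rewrite (negPf st) (negPf us) (negPf ts) (negPf su) /=.
move: arc_st arc_us; rewrite /arc (f_subC su) -eq_f.
case: s t u {st us ts su eq_f} => [g i] [h j] [k l] /=.
by case: (f _); case: i j l b => [] [] [] [].
Qed.

Lemma splits_two_fibres g h i j l m : g != h -> l != m ->
  splits (inr (g, i)) (inr (g, j)) (inr (h, l)) (inr (h, m)).
Proof.
move=> gh; have hg : h != g by rewrite eq_sym.
rewrite /splits_colour /sym_sum /= !inE ?eqxx ?orbT ?(negPf hg) ?(negPf gh) /=.
by case: (f _); case: l m => [] [].
Qed.

Lemma splits_arc_fibre b g h i j : g != h -> arc b (g, i) (h, j) ->
  splits (inr (g, i)) (inr (h, j)) (inl b) (inr (g, ~~ i)).
Proof.
move=> gh arc_gh; have hg : h != g by rewrite eq_sym.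
rewrite /splits_colour /sym_sum /= !inE /head /tail arc_gh ?eqxx ?orbT ?(negPf hg) ?(negPf gh) /=.
by case: (f _); case: i j {arc_gh} => [] [].
Qed.

Lemma splits_generic g h k i j l m : uniq [:: g; h; k] -> l != m ->
  splits (inr (g, i)) (inr (h, j)) (inr (k, l)) (inr (k, m)).
Proof.
rewrite /= !inE negb_or andbT => /andP[/andP[gh gk] hk].
rewrite /splits_colour /sym_sum /= !inE ![k == _]eq_sym ![h == g]eq_sym.
rewrite (negPf gh) (negPf gk) (negPf hk) /= eqxx opprD addrACA subrr add0r => lm.
by have := omega_mulrb_coset (rank_coef_neq0 k g h) lm; rewrite !inE.
Qed.

Lemma shadow_central b s r :
  (sym_sum shadow (inl b) (inr s) r == s.1 + s.1 + s.1) = fibre s.1 r.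
Proof.
case: r => [c|t]; rewrite /sym_sum /= ?eqxx // /tail; case: ifP => _.
  by rewrite (inj_eq (addrI _)).
by rewrite addrAC (inj_eq (addIr _)) -!mulr2n (inj_eq mulr2n_inj).
Qed.

Lemma shadow_splits_inf_inf b c : shadow_splits shadow offset coef (inl b) (inl c).
Proof.
move=> [d|s] [d'|t]; try by [move=> /no_three_inf | move=> _ /no_three_inf].
move=> bcs bct st.
rewrite /sym_sum /= -!mulr2n -!mulrSr => /mulr3n_inj eq_st.
by apply: (@splits_central s.1); rewrite //= eq_st.
Qed.

Lemma arc_inj b s t u : t.1 = u.1 -> arc b s t = arc b s u -> t = u.
Proof.
case: t u => [g i] [h j] /= <-; rewrite /arc /= => eq_arc; congr (_, _).
by move: eq_arc; case: (f _); case: s.2 i j b => [] [] [] [].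
Qed.

Lemma arc_out_in_f s t u : s.1 + s.1 + t.1 = u.1 + s.1 + u.1 -> f (t.1 - s.1) = f (u.1 - s.1).
Proof.
move=> eq_stu; rewrite -[RHS]f_twice; congr f.
have eq_tsu : t.1 + s.1 = u.1 + u.1.
  by apply: (addIr s.1); rewrite [RHS]addrAC -eq_stu [RHS]addrC addrA.
by rewrite mulr2n addrACA -eq_tsu addrA addrK.
Qed.

Lemma splits_inf_fin_arcs b s t u : t.1 != s.1 -> u.1 != s.1 -> t != u ->
  (tail b s t).1 + s.1 + t.1 = (tail b s u).1 + s.1 + u.1 ->
  splits (inl b) (inr s) (inr t) (inr u).
Proof.
move=> ts us tu; have [st su] : s.1 != t.1 /\ s.1 != u.1 by rewrite ![s.1 == _]eq_sym.
have arc_neq : t.1 = u.1 -> arc b s t != arc b s u.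
  by move=> eq_tu; apply: contra tu => /eqP/(arc_inj eq_tu)->.
rewrite /tail; case: ifP => arc_t; case: ifP => arc_u.
- by move=> /addrI/arc_neq; rewrite arc_t arc_u.
- by move=> /arc_out_in_f eq_f; apply: splits_arc_out_in; rewrite // arcC // arc_u.
- move=> /esym/arc_out_in_f eq_f; rewrite splits_colourCr.
  by apply: splits_arc_out_in; rewrite // arcC // arc_t.
rewrite ![_ + s.1]addrC -!addrA -!mulr2n => /addrI/mulr2n_inj/arc_neq.
by rewrite arc_t arc_u.
Qed.

Lemma shadow_splits_inf_fin b s : shadow_splits shadow offset coef (inl b) (inr s).
Proof.
move=> r r' bsr bsr' rr' eq_shadow; have := shadow_central b s r'.
rewrite -eq_shadow shadow_central; case: (boolP (fibre s.1 r)) => [rs r's | rs].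
  by apply: (@splits_central s.1); rewrite /= ?eqxx.
case: r r' rs rr' eq_shadow {bsr bsr'} => [//|t] [//|u] ts tu eq_shadow us.
by apply: (splits_inf_fin_arcs ts (negbT (esym us)) _ eq_shadow); apply: contra tu => /eqP->.
Qed.

Lemma shadow_splits_fibre g i j :
  shadow_splits shadow offset coef (inr (g, i)) (inr (g, j)).
Proof.
have shadow_tail b h l : sym_sum shadow (inr (g, i)) (inr (g, j)) (inl b) =
    sym_sum shadow (inr (g, i)) (inr (g, j)) (inr (h, l)) -> h = g.
  by rewrite /sym_sum /= /tail; case: ifP => _ /addrI.
move=> [b|[h l]] [c|[k m]].
- by move=> gib gic bc _; apply: (@splits_central g); rewrite /= ?eqxx.
- by move=> _ + _ /shadow_tail eq_kg; rewrite eq_kg => /no_three_fibre.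
- by move=> + _ _ /esym/shadow_tail eq_hg; rewrite eq_hg => /no_three_fibre.
rewrite /sym_sum /= => gh _ hk /addrI eq_hk; rewrite -{}eq_hk in hk *.
apply: splits_two_fibres; last by rewrite fibre_eqE in hk.
by apply: contraTneq gh => <-; apply/negP/no_three_fibre.
Qed.

Lemma splits_fin_fin_inf b g h k i j l : g != h -> (tail b (g, i) (h, j)).1 = k ->
  uniq [:: inr (g, i); inr (h, j); inr (k, l) : point] ->
  splits (inr (g, i)) (inr (h, j)) (inl b) (inr (k, l)).
Proof.
move=> gh; have eq_negb x y : x != y -> y = ~~ x by case: x y => [] [].
rewrite /tail; case: ifP => arc_gh /= <- /=; rewrite !inE !andbT negb_or fibre_eqE.
  by move=> /andP[/andP[_ /eq_negb->] _]; apply: splits_arc_fibre.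
move=> /andP[_ /eq_negb->]; rewrite (splits_colourC offsetC coefC).
by apply: splits_arc_fibre; [rewrite eq_sym | rewrite arcC // arc_gh].
Qed.

Lemma tail_inf_inj b c g h i j : g != h ->
  (tail b (g, i) (h, j)).1 = (tail c (g, i) (h, j)).1 -> b = c.
Proof.
rewrite /tail => gh; suff eq_arc : arc b (g, i) (h, j) = arc c (g, i) (h, j) -> b = c.
  move=> eq_tail; apply: eq_arc; move: eq_tail.
  by case: (arc b _ _); case: (arc c _ _) => //= eq_gh; rewrite eq_gh eqxx in gh.
by rewrite /arc /=; case: (f _); case: i j b c => [] [] [] [].
Qed.

Lemma shadow_splits_fin_fin s t : shadow_splits shadow offset coef (inr s) (inr t).
Proof.
case: s t => [g i] [h j]; case: (eqVneq g h) => [<-|gh]; first exact: shadow_splits_fibre.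
move=> [b|[k l]] [c|[k' l']]; rewrite {1 2}/sym_sum /= => str str' rr' /addrI eq_tail.
- by case/eqP: rr'; rewrite (tail_inf_inj gh eq_tail).
- exact: splits_fin_fin_inf.
- by rewrite splits_colourCr; apply: splits_fin_fin_inf.
rewrite -{k'}eq_tail in str' rr' *; rewrite fibre_eqE in rr'.
have neq_k x m : inr (x, m) != inr (k, l) :> point -> inr (x, m) != inr (k, l') :> point ->
    x != k.
  case: (eqVneq x k) => // ->; rewrite !fibre_eqE.
  by move: rr'; case: l l' m {str str'} => [] [] [].
move: str str'; rewrite /= !inE !negb_or !andbT => /andP[/andP[_ gk] hk] /andP[/andP[_ gk'] hk'].
by apply: splits_generic => //; rewrite /= !inE negb_or gh (neq_k _ _ gk gk') (neq_k _ _ hk hk').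
Qed.

Lemma shadow_splitsP p q : shadow_splits shadow offset coef p q.
Proof.
case: p q => [b|s] [c|t]; first exact: shadow_splits_inf_inf.
- exact: shadow_splits_inf_fin.
- move=> r r'; rewrite !(sym_sumC shadowC (inr s)) ![uniq [:: inr s; _; _]]uniq3C.
  by rewrite (splits_colourC offsetC coefC); apply: shadow_splits_inf_fin.
exact: shadow_splits_fin_fin.
Qed.

Lemma TOC_of_half_system n : n = (2 * #|G| + 2)%N -> exists P, TOC 3 n 3 3 P.
Proof.
move=> nG; have card_point : n = #|{: point}|.
  by rewrite nG card_sum card_prod card_bool mulnC addnC.
apply: (@TOC_of_triple_colouring n point (G * F4)%type (affine_colour shadow offset coef)
  (0, 0) (fun a : 'I_n => enum_val (cast_ord card_point a))).
- by move=> a c /enum_val_inj/cast_ord_inj.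
- exact: affine_colourC shadowC offsetC coefC.
- exact: affine_colourCr shadowC offsetC coefC.
- exact: affine_colour_inj coefC coef_neq0 coef_neq shadow_splitsP.
- exact: affine_colour_flip coef_neq.
by rewrite nG addnK !card_prod card_bool mulnC -mulnA.
Qed.

End Construction.

Section HalfSystem.
Variables (G : finZmodType) (k : nat).
Hypothesis odd_k : odd k.
Hypothesis mulr2nk : forall x : G, x *+ 2 ^ k = x.

Definition twice (x : G) : G := x *+ 2.

Lemma iter_twice i (x : G) : iter i twice x = x *+ 2 ^ i.
Proof. by elim: i => //= i ->; rewrite /twice -mulrnA expnSr. Qed.

Lemma twice_inj : injective twice.
Proof.
apply: injective_mulrn => x x0; rewrite -(mulr2nk x) -(prednK (odd_gt0 odd_k)).
by rewrite expnS mulrnA x0 mul0rn.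
Qed.

Lemma fconnect_twice_opp (x : G) : fconnect twice x (- x) -> x = 0.
Proof.
move=> /iter_findex; rewrite iter_twice; move: (findex _ _ _) => i eq_opp.
have iter_opp m : x *+ (2 ^ i) ^ m = if odd m then - x else x.
  elim: m => // m IHm; rewrite expnSr mulrnA IHm /=.
  by case: (odd m); rewrite /= ?mulNrn ?eq_opp ?opprK.
have mulr2nki : x *+ (2 ^ k) ^ i = x.
  by elim: i {eq_opp iter_opp} => //= i IHi; rewrite expnS mulrnA mulr2nk.
apply: twice_inj; rewrite /twice mul0rn mulr2n; apply/eqP; rewrite addr_eq0.
by rewrite -{1}mulr2nki expnAC iter_opp odd_k.
Qed.

Definition half_system (x : G) : bool :=
  (enum_rank (froot twice x) < enum_rank (froot twice (- x)))%N.

Lemma half_system_twice (x : G) : half_system (x *+ 2) = half_system x.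
Proof.
have root_twice y : froot twice (y *+ 2) = froot twice y.
  apply/esym/eqP; rewrite root_connect; last exact: fconnect_sym twice_inj.
  exact: (fconnect1 twice).
by rewrite /half_system -mulNrn !root_twice.
Qed.

Lemma half_system_opp (x : G) : x != 0 -> half_system (- x) = ~~ half_system x.
Proof.
move=> x0; rewrite /half_system opprK -leqNgt ltn_neqAle (inj_eq val_inj).
rewrite (inj_eq enum_rank_inj) eq_sym root_connect; last exact: fconnect_sym twice_inj.
by rewrite (contra_neqN (@fconnect_twice_opp x)).
Qed.

Lemma TOC_of_odd_order_of_2 n : n = (2 * #|G| + 2)%N -> exists P, TOC 3 n 3 3 P.
Proof. exact: TOC_of_half_system half_system_twice half_system_opp n. Qed.

End HalfSystem.

Lemma mulrn_rV_ord0 N m (x : 'rV['I_N.+1]_m) : x *+ N.+1 = 0.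
Proof.
by apply/rowP=> i; rewrite mulmxnE mxE; apply: val_inj; rewrite Zp_mulrn /= modnMl.
Qed.

Lemma TOC_of_mersenne k m : odd k ->
  exists P, TOC 3 (2 * (2 ^ k).-1 ^ m + 2)%N 3 3 P.
Proof.
move=> odd_k; have [N defN] : exists N, (2 ^ k = N.+2)%N.
  by case: k odd_k => // k _; exists (2 ^ k.+1).-2%N; have := expn_gt0 2 k; rewrite expnS; lia.
apply: (@TOC_of_odd_order_of_2 'rV['I_N.+1]_m k) => // [x|].
  by rewrite defN mulrS mulrn_rV_ord0 addr0.
by rewrite card_mx card_ord mul1n defN.
Qed.

Local Close Scope ring_scope.

Theorem theorem4p4 (n : nat) :
  inK n -> exists P : {set {set word 3 n}}, TOC 3 n 3 3 P.
Proof.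
case=> [[[|m] [// _ ->]] | [p [m [pK [_ ->]]]]].
  have <- : 2 * (2 ^ m.*2.+1).-1 ^ 1 + 2 = 4 ^ m.+1.
    have := expn_gt0 2 m.*2.+1.
    by rewrite expn1 -[4]/(2 ^ 2) -expnM [2 * m.+1]mul2n doubleS [2 ^ _.+2]expnS; lia.
  by apply: TOC_of_mersenne; rewrite /= odd_double.
move: pK; rewrite !inE => /or3P[]/eqP->.
- exact: (@TOC_of_mersenne 3).
- exact: (@TOC_of_mersenne 5).
- exact: (@TOC_of_mersenne 7).
Qed.
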